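(* Let $m_1\ge1$ and $m_2\ge4$ be integers with $m_2\ge m_1+1$, and let $\beta_0=0,\beta_1,\dots,\beta_{m_1}$ be pairwise distinct non-negative integers with $\max_j\beta_j=m_2$. Let $H$ be real with $\log H\ge m_2(\log m_2)^2e^{m_2(\log m_2)^2}$. Then for every $(\lambda_0,\lambda_1,\dots,\lambda_{m_1})\in\mathbb{Z}_{\mathbb{I}}^{m_1+1}\setminus\{0\}$ with $\max_{1\le i\le m_1}|\lambda_i|\le H$, the polynomial $P(x)=\lambda_0+\lambda_1x^{\beta_1}+\dots+\lambda_{m_1}x^{\beta_{m_1}}$ satisfies \[ |P(e)|>H^{-m_1-\frac{\rho(m_1^2+3m_1+2)\log m_2}{\log\log H}}, \] where one may take $\rho=12.88$ for all $m_2\ge4$, and $\rho=2$ when $m_2\ge11$.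
   Context: $\mathbb{I}$ is an imaginary quadratic field and $\mathbb{Z}_{\mathbb{I}}$ its ring of integers. *)

(* Defs.v *)
From Stdlib Require Import Reals ZArith.
From Coquelicot Require Import Coquelicot.
Open Scope R_scope.

(* An imaginary quadratic field is Q(sqrt(-d)) with d a positive squarefree
   integer. *)
Definition squarefree_pos (d : Z) : Prop :=
  (0 < d)%Z /\ forall k : Z, Z.divide (k * k) d -> k = 1%Z \/ k = (-1)%Z.

(* Generator omega of the ring of integers Z_I = Z[omega] of Q(sqrt(-d)),
   embedded in C:  omega = (1 + i sqrt d)/2 if -d = 1 mod 4 (i.e. d = 3 mod 4),
   omega = i sqrt d otherwise. *)
Definition qomega (d : Z) : C :=
  if Z.eqb (Z.modulo d 4) 3 then (1 / 2, sqrt (IZR d) / 2)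
  else (0, sqrt (IZR d)).

Definition in_ZI (d : Z) (z : C) : Prop :=
  exists a b : Z, z = Cplus (RtoC (IZR a)) (Cmult (RtoC (IZR b)) (qomega d)).

Definition P_at_e (m1 : nat) (lambda : nat -> C) (beta : nat -> nat) : C :=
  sum_n (fun i => Cmult (lambda i) (RtoC (exp 1 ^ beta i))) m1.

Definition lower_bound (rho H : R) (m1 m2 : nat) : R :=
  Rpower H (- INR m1 - rho * (INR m1 ^ 2 + 3 * INR m1 + 2) * ln (INR m2)
                        / ln (ln H)).

(* Main.v *)
(** Hermite's approximations.  For each k, the polynomial
    f_k(X) = (X - beta_k)^(N-1) prod_{j <> k} (X - beta_j)^N and the moments
    A_{k,i} = int_0^oo exp(-u) f_k(u + beta_i) du are such that (N-1)! divides A_{k,i} and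
    exp(beta_i) A_{k,0} - A_{k,i} is small.  With B_{k,i} = A_{k,i} / (N-1)! and
    N = 1 mod m2!, the matrix B is, mod N, diagonal with unit entries; a descent then gives
    some k with sum_i lambda_i B_{k,i} <> 0, and a nonzero element of Z_I has modulus at
    least 1.  Hence |P(e)| >= (N-1)! / (2 |A_{k,0}|) as soon as the remainders, multiplied
    by H, are small compared with (N-1)!.  The theorem follows by taking N minimal up to
    rounding, that is N ~ log H / (y - log y) with
    y = log log H - (m1 + 1) log m2 - 1.1. *)

Require Import Defs.
From Stdlib Require Import Reals ZArith Znumtheory Lra Lia List Classical.
From Coquelicot Require Import Coquelicot.
Open Scope R_scope.

(** * Moments of products of linear factors *)

(* [hmom a cs] is the image of X^a * prod_{c in cs} (X + c) under the linear map
   X^s |-> s!, that is, the integral over [0, +oo[ of exp(-u) times that polynomial. *)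
Fixpoint hmom (a : nat) (cs : list R) : R :=
  match cs with
  | nil => INR (fact a)
  | c :: cs' => hmom (S a) cs' + c * hmom a cs'
  end.

Fixpoint hmomZ (a : nat) (cs : list Z) : Z :=
  match cs with
  | nil => Z.of_nat (fact a)
  | c :: cs' => (hmomZ (S a) cs' + c * hmomZ a cs')%Z
  end.

Definition prodR (cs : list R) : R := fold_right Rmult 1 cs.
Definition prodZ (cs : list Z) : Z := fold_right Z.mul 1%Z cs.

Lemma hmom_IZR (cs : list Z) (a : nat) : hmom a (map IZR cs) = IZR (hmomZ a cs).
Proof.
  revert a; induction cs as [|c cs IH]; intros a; simpl.
  - apply INR_IZR_INZ.
  - now rewrite !IH, plus_IZR, mult_IZR.
Qed.

(** A zero shift is a factor X, which only raises the exponent [a]. *)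
Lemma hmomZ_zeros (l1 l2 : list Z) (n a : nat) :
  hmomZ a (l1 ++ repeat 0%Z n ++ l2) = hmomZ (a + n) (l1 ++ l2).
Proof.
  revert a; induction l1 as [|c l1 IH]; intros a; simpl.
  - revert a; induction n as [|n IH]; intros a; simpl.
    + now rewrite Nat.add_0_r.
    + rewrite IH. replace (a + S n)%nat with (S a + n)%nat by lia. lia.
  - now rewrite !IH.
Qed.

Lemma fact_S_Z (a : nat) : Z.of_nat (fact (S a)) = (Z.of_nat (S a) * Z.of_nat (fact a))%Z.
Proof. rewrite <- Nat2Z.inj_mul. reflexivity. Qed.

(** For s >= 1 the factorial (a+s)! is a multiple of (a+1)!, so modulo (a+1)! only the constant term
    of the product survives. *)
Lemma hmomZ_mod_fact (cs : list Z) (a : nat) :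
  exists q : Z, hmomZ a cs = (Z.of_nat (fact a) * (prodZ cs + Z.of_nat (S a) * q))%Z.
Proof.
  revert a; induction cs as [|c cs IH]; intros a; cbn [hmomZ prodZ fold_right].
  - exists 0%Z. lia.
  - destruct (IH a) as [q Hq]. destruct (IH (S a)) as [r Hr].
    exists (prodZ cs + Z.of_nat (S (S a)) * r + c * q)%Z.
    rewrite Hq, Hr, fact_S_Z. fold (prodZ cs). ring.
Qed.

(** The bound is a! (a+M+1) ... (a+M+[length cs]), cleared of the denominator (a+M)!. One more
    factor X + c contributes a+1 through the higher exponent and at most M through c, and these add
    up to a+M+1. *)
Lemma hmom_bound (M : nat) (cs : list R) (a : nat) :
  (forall c, In c cs -> Rabs c <= INR M) ->
  Rabs (hmom a cs) * INR (fact (a + M)) <= INR (fact a) * INR (fact (a + M + length cs)).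
Proof.
  revert a; induction cs as [|c cs IH]; intros a Hc; cbn [hmom length].
  - rewrite Nat.add_0_r, Rabs_pos_eq; [lra | apply pos_INR].
  - assert (Hcs : forall c', In c' cs -> Rabs c' <= INR M) by (intros; apply Hc; now right).
    pose proof (IH (S a) Hcs) as H1. pose proof (IH a Hcs) as H2.
    assert (Hc0 : Rabs c <= INR M) by (apply Hc; now left).
    replace (S a + M + length cs)%nat with (a + M + S (length cs))%nat in H1 by lia.
    replace (fact (S a + M)) with (S (a + M) * fact (a + M))%nat in H1 by reflexivity.
    replace (fact (S a)) with (S a * fact a)%nat in H1 by reflexivity.
    rewrite !mult_INR in H1.
    assert (H3 : (INR (a + M) + 1) * INR (fact (a + M + length cs))
                 <= INR (fact (a + M + S (length cs)))).
    { replace (a + M + S (length cs))%nat with (S (a + M + length cs)) by lia.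
      replace (fact (S (a + M + length cs)))
        with (S (a + M + length cs) * fact (a + M + length cs))%nat by reflexivity.
      rewrite mult_INR. apply Rmult_le_compat_r; [apply pos_INR|].
      rewrite <- S_INR. apply le_INR. lia. }
    rewrite S_INR in H1. rewrite S_INR in H1. rewrite plus_INR in *.
    pose proof (Rabs_triang (hmom (S a) cs) (c * hmom a cs)) as H4.
    rewrite Rabs_mult in H4.
    assert (H5 : Rabs c * Rabs (hmom a cs) <= INR M * Rabs (hmom a cs))
      by (apply Rmult_le_compat_r; [apply Rabs_pos | assumption]).
    set (F0 := INR (fact (a + M))) in *. set (F1 := INR (fact (a + M + length cs))) in *.
    set (F2 := INR (fact (a + M + S (length cs)))) in *. set (f := INR (fact a)) in *.
    set (A := INR a) in *. set (B := INR M) in *.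
    set (h1 := Rabs (hmom (S a) cs)) in *. set (h0 := Rabs (hmom a cs)) in *.
    assert (0 < F0) by apply INR_fact_lt_0. assert (0 < f) by apply INR_fact_lt_0.
    assert (0 <= A) by apply pos_INR. assert (0 <= B) by apply pos_INR.
    apply Rle_trans with ((h1 + B * h0) * F0); [apply Rmult_le_compat_r; lra|].
    apply Rmult_le_reg_l with (A + B + 1); [lra|].
    assert (B * (h0 * F0) * (A + B + 1) <= B * (f * F1) * (A + B + 1)).
    { apply Rmult_le_compat_r; [lra|]. apply Rmult_le_compat_l; lra. }
    assert (B * f * ((A + B + 1) * F1) <= B * f * F2).
    { apply Rmult_le_compat_l; [nra | assumption]. }
    nra.
Qed.

(** This is integration by parts in the integral of exp(-u) u^a prod (u + t + c): for exponent 0 a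
    boundary term at u = 0 appears, for a positive exponent the derivative of the power of u. Both
    cases share one induction, since an added factor turns exponent 0 into exponent 1. *)
Lemma hmom_derive (cs : list R) (x : R) :
  is_derive (fun t => hmom 0 (map (Rplus t) cs)) x
    (hmom 0 (map (Rplus x) cs) - prodR (map (Rplus x) cs)) /\
  forall a, is_derive (fun t => hmom (S a) (map (Rplus t) cs)) x
    (hmom (S a) (map (Rplus x) cs) - INR (S a) * hmom a (map (Rplus x) cs)).
Proof.
  induction cs as [|c cs [IH0 IH]]; cbn [hmom map prodR fold_right].
  - split.
    + replace (INR (fact 0) - 1) with 0 by (simpl; ring). apply @is_derive_const.
    + intros a. replace (fact (S a)) with (S a * fact a)%nat by reflexivity.
      rewrite mult_INR, Rminus_diag. apply @is_derive_const.
  - assert (Hid : is_derive (fun t => t + c) x 1) by (auto_derive; auto; ring).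
    split.
    + pose proof (is_derive_plus _ _ _ _ _ (IH 0%nat)
        (is_derive_mult _ _ _ _ _ Hid IH0 Rmult_comm)) as Hd.
      eapply (eq_ind _ (is_derive _ x)); [exact Hd|].
      unfold plus, mult; simpl. fold (prodR (map (Rplus x) cs)). ring.
    + intros a.
      pose proof (is_derive_plus _ _ _ _ _ (IH (S a))
        (is_derive_mult _ _ _ _ _ Hid (IH a) Rmult_comm)) as Hd.
      eapply (eq_ind _ (is_derive _ x)); [exact Hd|].
      rewrite !S_INR. unfold plus, mult; simpl. ring.
Qed.

Lemma exp_le_compat (x y : R) : x <= y -> exp x <= exp y.
Proof.
  intros [Hlt | ->]; [left; now apply exp_increasing | apply Rle_refl].
Qed.

Lemma prodR_bound (M : R) (cs : list R) :
  0 <= M -> (forall c, In c cs -> Rabs c <= M) -> Rabs (prodR cs) <= M ^ length cs.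
Proof.
  intros HM. induction cs as [|c cs IH]; intros Hc; cbn [prodR fold_right length pow].
  - rewrite Rabs_R1. lra.
  - rewrite Rabs_mult. apply Rmult_le_compat; try apply Rabs_pos.
    + apply Hc. now left.
    + apply IH. intros; apply Hc; now right.
Qed.

(** [phi t] is the integral of exp(-v) prod (v + c) over [t, +oo[, so the difference is exp b times
    the integral over [0, b]. The mean value theorem replaces this integral by a value at some xi in
    [0, b], where each |xi + c| is at most M. *)
Lemma hmom_shift_approx (cs : list R) (b M : R) :
  0 <= b <= M -> (forall c, In c cs -> - M <= c <= 0) ->
  Rabs (exp b * hmom 0 cs - hmom 0 (map (Rplus b) cs)) <= M * exp M * M ^ length cs.
Proof.
  intros Hb Hc.
  set (phi := fun t => exp (- t) * hmom 0 (map (Rplus t) cs)).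
  assert (Hphi : forall t, is_derive phi t (- (exp (- t) * prodR (map (Rplus t) cs)))).
  { intros t. destruct (hmom_derive cs t) as [Hd _].
    assert (He : is_derive (fun t => exp (- t)) t (- exp (- t))) by (auto_derive; auto; ring).
    pose proof (is_derive_mult _ _ _ _ _ He Hd Rmult_comm) as Hm.
    eapply (eq_ind _ (is_derive _ t)); [exact Hm|].
    unfold plus, mult; simpl. ring. }
  destruct (MVT_gen phi 0 b (fun t => - (exp (- t) * prodR (map (Rplus t) cs)))) as [xi [Hxi Heq]].
  - intros; apply Hphi.
  - intros. apply continuity_pt_filterlim. apply (ex_derive_continuous phi).
    eexists; apply Hphi.
  - rewrite Rmin_left, Rmax_right in Hxi by lra.
    assert (Heq' : exp b * hmom 0 cs - hmom 0 (map (Rplus b) cs)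
                   = exp (b - xi) * prodR (map (Rplus xi) cs) * b).
    { unfold phi in Heq. rewrite Ropp_0, exp_0 in Heq.
      replace (map (Rplus 0) cs) with cs in Heq.
      2:{ rewrite <- (map_id cs) at 1. apply map_ext. intros; ring. }
      replace (exp (b - xi)) with (exp b * exp (- xi)) by (rewrite <- exp_plus; f_equal; ring).
      assert (exp b * exp (- b) = 1) by (rewrite <- exp_plus, Rplus_opp_r; apply exp_0).
      replace (exp b * hmom 0 cs) with (exp b * (1 * hmom 0 cs)) by ring.
      replace (hmom 0 (map (Rplus b) cs))
        with (exp b * (exp (- b) * hmom 0 (map (Rplus b) cs))) by
        (rewrite <- Rmult_assoc, H; ring).
      rewrite <- Rmult_minus_distr_l.
      replace (1 * hmom 0 cs - exp (- b) * hmom 0 (map (Rplus b) cs))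
        with (- (exp (- b) * hmom 0 (map (Rplus b) cs) - 1 * hmom 0 cs)) by ring.
      rewrite Heq. ring. }
    rewrite Heq', !Rabs_mult, (Rabs_pos_eq (exp _)), (Rabs_pos_eq b)
      by (try (left; apply exp_pos); lra).
    assert (Hp : Rabs (prodR (map (Rplus xi) cs)) <= M ^ length cs).
    { rewrite <- (length_map (Rplus xi) cs). apply prodR_bound; [lra|].
      intros c Hin. apply in_map_iff in Hin. destruct Hin as [c' [<- Hin]].
      specialize (Hc c' Hin). apply Rabs_le. lra. }
    assert (exp (b - xi) <= exp M) by (apply exp_le_compat; lra).
    pose proof (exp_pos (b - xi)). pose proof (Rabs_pos (prodR (map (Rplus xi) cs))).
    apply Rle_trans with (exp M * M ^ length cs * M); [|right; ring].
    apply Rmult_le_compat; try lra; [apply Rmult_le_pos; lra|].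
    apply Rmult_le_compat; lra.
Qed.

(** * Arithmetic of the moments *)

(** These are the constants of the linear factors of f(X + b), where f has the root [beta j] with
    multiplicity [e j]. *)
Definition shifts (beta e : nat -> nat) (b : Z) (js : list nat) : list Z :=
  flat_map (fun j => repeat (b - Z.of_nat (beta j))%Z (e j)) js.

Lemma shifts_length (beta e : nat -> nat) (b : Z) (js : list nat) (N : nat) :
  (forall j, e j <= N)%nat -> (length (shifts beta e b js) <= length js * N)%nat.
Proof.
  intros He. unfold shifts. induction js as [|j js IH]; cbn [flat_map length]; [lia|].
  rewrite length_app, repeat_length. specialize (He j). lia.
Qed.

Lemma shifts_In (beta e : nat -> nat) (b c : Z) (js : list nat) :
  In c (shifts beta e b js) -> exists j, In j js /\ c = (b - Z.of_nat (beta j))%Z.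
Proof.
  intros Hc. apply in_flat_map in Hc. destruct Hc as [j [Hj Hc]].
  exists j. split; [assumption|]. now apply repeat_spec in Hc.
Qed.

Lemma shifts_translate (beta e : nat -> nat) (b : Z) (js : list nat) :
  shifts beta e b js = map (Z.add b) (shifts beta e 0 js).
Proof.
  unfold shifts. induction js as [|j js IH]; cbn [flat_map]; [reflexivity|].
  now rewrite map_app, map_repeat, IH.
Qed.

Lemma rel_prime_prodZ (n : Z) (cs : list Z) :
  (forall c, In c cs -> rel_prime n c) -> rel_prime n (prodZ cs).
Proof.
  induction cs as [|c cs IH]; intros Hc; cbn [prodZ fold_right].
  - apply rel_prime_sym, rel_prime_1.
  - apply rel_prime_mult; [apply Hc; now left|]. apply IH. intros; apply Hc; now right.
Qed.

Lemma divide_fact (n k : nat) : (1 <= k <= n)%nat -> Nat.divide k (fact n).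
Proof.
  induction n as [|n IH]; intros Hk; [lia|].
  change (fact (S n)) with (S n * fact n)%nat.
  destruct (Nat.eq_dec k (S n)) as [->|Hne].
  - apply Nat.divide_factor_l.
  - apply Nat.divide_mul_r, IH. lia.
Qed.

(** Since |c| divides M!, the number M! q + 1 is 1 modulo c; the sign of c goes into the Bezout
    coefficient. *)
Lemma rel_prime_succ_fact (M q : nat) (c : Z) :
  (c <> 0)%Z -> (Z.abs c <= Z.of_nat M)%Z -> rel_prime (Z.of_nat (fact M * q + 1)) c.
Proof.
  intros Hc0 HcM.
  destruct (divide_fact M (Z.abs_nat c)) as [r Hr]; [lia|].
  apply rel_prime_sym, bezout_rel_prime.
  apply Bezout_intro with (- (Z.of_nat r * Z.of_nat q * Z.sgn c))%Z 1%Z.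
  rewrite Hr, Nat2Z.inj_add, !Nat2Z.inj_mul, Zabs2Nat.id_abs.
  replace (Z.abs c) with (Z.sgn c * c)%Z by (destruct c; simpl; lia).
  change (Z.of_nat 1) with 1%Z. ring.
Qed.

Fixpoint zsum (f : nat -> Z) (n : nat) : Z :=
  match n with O => f O | S p => (zsum f p + f (S p))%Z end.

Lemma zsum_ext (f g : nat -> Z) (n : nat) :
  (forall i, (i <= n)%nat -> f i = g i) -> zsum f n = zsum g n.
Proof.
  induction n as [|n IH]; intros Hfg; simpl; [now apply Hfg|].
  rewrite IH, Hfg; auto.
Qed.

Lemma zsum_scal (c : Z) (f : nat -> Z) (n : nat) :
  zsum (fun i => c * f i)%Z n = (c * zsum f n)%Z.
Proof. induction n as [|n IH]; simpl; [reflexivity|]. rewrite IH. ring. Qed.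

Lemma zsum_divide_single (d : Z) (f : nat -> Z) (n k : nat) :
  (k <= n)%nat -> (forall i, (i <= n)%nat -> i <> k -> (d | f i)%Z) ->
  (d | zsum f n)%Z -> (d | f k)%Z.
Proof.
  intros Hk Hf Hs.
  assert (Hd : forall p, (p <= n)%nat -> (p < k)%nat -> (d | zsum f p)%Z).
  { induction p as [|p IH]; intros H1 H2; simpl; [apply Hf; lia|].
    apply Z.divide_add_r; [apply IH|apply Hf]; lia. }
  assert (Hd2 : forall p, (p <= n)%nat -> (k <= p)%nat -> (d | zsum f p - f k)%Z).
  { induction p as [|p IH]; intros H1 H2; simpl.
    - replace k with O by lia. rewrite Z.sub_diag. apply Z.divide_0_r.
    - destruct (Nat.eq_dec k (S p)) as [->|Hne].
      + replace (zsum f p + f (S p) - f (S p))%Z with (zsum f p) by ring. apply Hd; lia.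
      + replace (zsum f p + f (S p) - f k)%Z with ((zsum f p - f k) + f (S p))%Z by ring.
        apply Z.divide_add_r; [apply IH|apply Hf]; lia. }
  replace (f k) with (zsum f n - (zsum f n - f k))%Z by ring.
  apply Z.divide_sub_r; [assumption|]. now apply Hd2.
Qed.

(* Infinite descent: a solution is divisible by [N], and its quotient by [N] is a solution. *)
Lemma diag_unit_mod_injective (N : Z) (B : nat -> nat -> Z) (m : nat) (a : nat -> Z) :
  (1 < N)%Z ->
  (forall k i, (k <= m)%nat -> (i <= m)%nat -> i <> k -> (N | B k i)%Z) ->
  (forall k, (k <= m)%nat -> rel_prime N (B k k)) ->
  (forall k, (k <= m)%nat -> zsum (fun i => a i * B k i)%Z m = 0%Z) ->
  forall i, (i <= m)%nat -> a i = 0%Z.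
Proof.
  intros HN Hoff Hdiag Ha.
  assert (Hpow : forall t : nat, forall a : nat -> Z,
    (forall k, (k <= m)%nat -> zsum (fun i => a i * B k i)%Z m = 0%Z) ->
    forall i, (i <= m)%nat -> (N ^ Z.of_nat t | a i)%Z).
  { clear a Ha. induction t as [|t IH]; intros a Ha i Hi; [apply Z.divide_1_l|].
    assert (HNa : forall k, (k <= m)%nat -> (N | a k)%Z).
    { intros k Hk. apply Gauss with (B k k); [|now apply Hdiag].
      rewrite Z.mul_comm.
      apply (zsum_divide_single N (fun i => a i * B k i)%Z m k Hk).
      - intros j Hj Hjk. apply Z.divide_mul_r. now apply Hoff.
      - rewrite Ha by assumption. apply Z.divide_0_r. }
    assert (Hq : forall k, (k <= m)%nat -> a k = (N * (a k / N))%Z).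
    { intros k Hk. apply Z_div_exact_full_2; [lia|].
      apply Z.mod_divide; [lia|]. now apply HNa. }
    rewrite Hq, Nat2Z.inj_succ, Z.pow_succ_r by lia.
    apply Z.mul_divide_mono_l.
    apply (IH (fun i => a i / N)%Z); [|assumption].
    intros k Hk. apply (Z.mul_reg_l _ _ N); [lia|].
    rewrite <- zsum_scal, Z.mul_0_r, <- (Ha k Hk). apply zsum_ext.
    intros j Hj. rewrite (Hq j Hj) at 2. ring. }
  intros i Hi.
  destruct (Z.eq_dec (a i) 0) as [|Hne]; [assumption|exfalso].
  (* The exponent |a i| is already too large: N^t > t for t = |a i|, so N^t cannot divide a nonzero
     [a i]. *)
  pose proof (Hpow (Z.to_nat (Z.abs (a i))) a Ha i Hi) as Hd.
  apply Z.divide_abs_r, Z.divide_pos_le in Hd; [|lia].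
  rewrite Z2Nat.id in Hd by lia.
  pose proof (Z.pow_gt_lin_r N (Z.abs (a i)) HN). lia.
Qed.

Definition dec_at (N k j : nat) : nat := if Nat.eqb j k then (N - 1)%nat else N.

(* Off the diagonal [(X + 0)^N] is a factor, so [N!] divides; on the diagonal only
   [(X + 0)^(N-1)] is, and the leading term is [(N-1)!] times a product of differences
   of the [beta], which are coprime to [N = 1 mod M!]. *)
Lemma hmomZ_shifts_mod (beta : nat -> nat) (m M q N k i : nat) :
  (forall i j, (i <= m)%nat -> (j <= m)%nat -> beta i = beta j -> i = j) ->
  (forall j, (j <= m)%nat -> (beta j <= M)%nat) ->
  N = (fact M * q + 1)%nat -> (1 < N)%nat -> (k <= m)%nat -> (i <= m)%nat ->
  exists B : Z,
    hmomZ 0 (shifts beta (dec_at N k) (Z.of_nat (beta i)) (seq 0 (S m)))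
      = (Z.of_nat (fact (N - 1)) * B)%Z /\
    (i <> k -> (Z.of_nat N | B)%Z) /\ (i = k -> rel_prime (Z.of_nat N) B).
Proof.
  intros Hinj HbM HN HN1 Hk Hi.
  assert (Hin : In i (seq 0 (S m))) by (apply in_seq; lia).
  (* The index i is split off because its shift is zero; the remaining shifts are nonzero, at most M
     in modulus, hence prime to N. *)
  apply in_split in Hin. destruct Hin as [l1 [l2 Hl]].
  pose proof (seq_NoDup (S m) 0) as Hnd. rewrite Hl in Hnd.
  apply NoDup_remove_2 in Hnd.
  assert (Hrest : forall j, In j (l1 ++ l2) -> (j <= m)%nat /\ j <> i).
  { intros j Hj. split; [|now intros ->].
    assert (Hj' : In j (seq 0 (S m))).
    { rewrite Hl. apply in_app_iff in Hj. apply in_app_iff. simpl. tauto. }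
    apply in_seq in Hj'. lia. }
  set (b := Z.of_nat (beta i)). set (e := dec_at N k).
  assert (Hs : hmomZ 0 (shifts beta e b (seq 0 (S m)))
               = hmomZ (e i) (shifts beta e b (l1 ++ l2))).
  { rewrite Hl. unfold shifts. rewrite !flat_map_app. cbn [flat_map].
    unfold b at 2. rewrite Z.sub_diag. apply hmomZ_zeros. }
  rewrite Hs.
  destruct (hmomZ_mod_fact (shifts beta e b (l1 ++ l2)) (e i)) as [r ->].
  assert (Hu : rel_prime (Z.of_nat N) (prodZ (shifts beta e b (l1 ++ l2)))).
  { apply rel_prime_prodZ. intros c Hc. apply shifts_In in Hc.
    destruct Hc as [j [Hj ->]]. destruct (Hrest j Hj) as [Hjm Hji]. subst N.
    pose proof (HbM j Hjm). pose proof (HbM i Hi).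
    apply rel_prime_succ_fact; unfold b; [|lia].
    intros Heq. apply Hji, Hinj; try assumption. lia. }
  set (u := prodZ (shifts beta e b (l1 ++ l2))) in *.
  assert (HSN : S (N - 1) = N) by lia.
  destruct (Nat.eq_dec i k) as [->|Hik].
  - exists (u + Z.of_nat N * r)%Z. unfold e, dec_at. rewrite Nat.eqb_refl, HSN.
    split; [reflexivity|]. split; [tauto|]. intros _. apply bezout_rel_prime.
    apply rel_prime_bezout in Hu. destruct Hu as [x y Hxy].
    apply Bezout_intro with (x - y * r)%Z y. rewrite <- Hxy. ring.
  (* Here the exponent is N, and N! = N (N-1)! supplies the factor N. *)
  - exists (Z.of_nat N * (u + Z.of_nat (S N) * r))%Z. unfold e, dec_at.
    apply Nat.eqb_neq in Hik as Hik'. rewrite Hik'.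
    split; [|split; [|tauto]].
    + rewrite <- HSN at 1. rewrite fact_S_Z, HSN. ring.
    + intros _. apply Z.divide_factor_l.
Qed.

(** * The linear form *)

(* [ring] does not see through the carrier projection left by [sum_n]. *)
Ltac eq_in_C := match goal with |- @eq _ ?x ?y => change (@eq C x y) end.

Lemma qomega_im_pos (d : Z) : (0 < d)%Z -> 0 < snd (qomega d).
Proof.
  intros Hd. pose proof (sqrt_lt_R0 (IZR d) (IZR_lt _ _ Hd)).
  unfold qomega. destruct (Z.eqb _ _); simpl; lra.
Qed.

(** The squared modulus is the norm, a rational integer, and it is positive when z is nonzero. *)
Lemma Cmod_in_ZI_ge_1 (d : Z) (z : C) :
  (0 < d)%Z -> in_ZI d z -> z <> RtoC 0 -> 1 <= Cmod z.
Proof.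
  intros Hd [a [b Hz]] Hz0.
  assert (Hs : sqrt (IZR d) * sqrt (IZR d) = IZR d)
    by (apply sqrt_sqrt, IZR_le; lia).
  assert (Hq : exists q : Z, fst z ^ 2 + snd z ^ 2 = IZR q).
  { subst z. unfold qomega. destruct (Z.eqb_spec (d mod 4) 3) as [H3|H3].
    - pose proof (Z.div_mod d 4 ltac:(lia)) as Hdm. rewrite H3 in Hdm.
      (* The norm is a^2 + ab + b^2 (d+1)/4, and (d+1)/4 = d/4 + 1 with the floor quotient because d
         = 3 mod 4. *)
      exists (a * a + a * b + b * b * (d / 4 + 1))%Z.
      rewrite !plus_IZR, !mult_IZR, plus_IZR.
      apply (f_equal IZR) in Hdm. rewrite plus_IZR, mult_IZR in Hdm.
      simpl. transitivity (IZR a * IZR a + IZR a * IZR b + IZR b * IZR b * (1 / 4)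
         + IZR b * IZR b * (sqrt (IZR d) * sqrt (IZR d)) / 4); [field|].
      rewrite Hs, Hdm. field.
    - exists (a * a + b * b * d)%Z. rewrite plus_IZR, !mult_IZR. rewrite <- Hs at 3.
      simpl. ring. }
  destruct Hq as [q Hq].
  assert (Hpos : 0 < fst z ^ 2 + snd z ^ 2).
  { destruct (Rle_lt_dec (fst z ^ 2 + snd z ^ 2) 0) as [Hle|]; [|assumption].
    exfalso. apply Hz0. destruct z as [x y]. cbn [fst snd] in *.
    assert (x = 0) by nra. assert (y = 0) by nra. now subst. }
  rewrite Hq in Hpos. apply (lt_IZR 0) in Hpos.
  unfold Cmod. rewrite Hq, <- sqrt_1. apply sqrt_le_1_alt, (IZR_le 1). lia.
Qed.

(** Index 0 is set apart since [lambda 0] is not bounded by H; its remainder vanishes because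
    [beta 0] is 0. *)
Lemma Cmod_sum_n_le (g : nat -> C) (c : R) (n : nat) :
  g 0%nat = RtoC 0 -> (forall i, (1 <= i <= n)%nat -> Cmod (g i) <= c) ->
  Cmod (sum_n g n) <= INR n * c.
Proof.
  intros H0. induction n as [|n IH]; intros Hg.
  - rewrite sum_O, H0, Cmod_0. simpl; lra.
  - rewrite sum_Sn, S_INR. eapply Rle_trans; [apply Cmod_triangle|].
    rewrite Rmult_plus_distr_r. apply Rplus_le_compat.
    + apply IH. intros; apply Hg; lia.
    + rewrite Rmult_1_l. apply Hg. lia.
Qed.

Lemma sum_n_lin_comb (a b B : nat -> Z) (w : C) (n : nat) :
  sum_n (fun i => Cmult (Cplus (RtoC (IZR (a i))) (Cmult (RtoC (IZR (b i))) w))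
                        (RtoC (IZR (B i)))) n
  = Cplus (RtoC (IZR (zsum (fun i => a i * B i)%Z n)))
          (Cmult (RtoC (IZR (zsum (fun i => b i * B i)%Z n))) w).
Proof.
  induction n as [|n IH].
  - rewrite sum_O. cbn [zsum]. rewrite !mult_IZR, !RtoC_mult. eq_in_C. ring.
  - rewrite sum_Sn, IH. cbn [zsum]. rewrite !plus_IZR, !mult_IZR, !RtoC_plus, !RtoC_mult.
    unfold plus; simpl. eq_in_C. ring.
Qed.

Lemma ZI_comb_eq_0 (d a b : Z) :
  (0 < d)%Z -> Cplus (RtoC (IZR a)) (Cmult (RtoC (IZR b)) (qomega d)) = RtoC 0 ->
  a = 0%Z /\ b = 0%Z.
Proof.
  intros Hd Heq. pose proof (qomega_im_pos d Hd) as Hw.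
  destruct (qomega d) as [u v]. injection Heq as Hre Him. simpl in Hw.
  assert (IZR b = 0) by nra.
  split; apply eq_IZR; nra.
Qed.

(** If every combination vanished, the coordinates of [lambda] on 1 and omega would solve two
    integer systems with matrix B, and both would be zero by [diag_unit_mod_injective]. *)
Lemma exists_nonzero_comb (d : Z) (N : Z) (B : nat -> nat -> Z) (m : nat) (lambda : nat -> C) :
  (0 < d)%Z -> (1 < N)%Z ->
  (forall k i, (k <= m)%nat -> (i <= m)%nat -> i <> k -> (N | B k i)%Z) ->
  (forall k, (k <= m)%nat -> rel_prime N (B k k)) ->
  (forall i, (i <= m)%nat -> in_ZI d (lambda i)) ->
  (exists i, (i <= m)%nat /\ lambda i <> RtoC 0) ->
  exists k, (k <= m)%nat /\
    1 <= Cmod (sum_n (fun i => Cmult (lambda i) (RtoC (IZR (B k i)))) m).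
Proof.
  intros Hd HN Hoff Hdiag HZ [i0 [Hi0 Hnz]].
  assert (Hab : exists a b : nat -> Z, forall i, (i <= m)%nat ->
    lambda i = Cplus (RtoC (IZR (a i))) (Cmult (RtoC (IZR (b i))) (qomega d))).
  (* Finite choice by induction on m turns the existential coordinates into functions. *)
  { clear - HZ. induction m as [|m IH].
    - destruct (HZ 0%nat (Nat.le_refl 0)) as [a [b Hl]].
      exists (fun _ => a), (fun _ => b). intros i Hi. now replace i with 0%nat by lia.
    - destruct IH as [a [b Hl]]; [intros; apply HZ; lia|].
      destruct (HZ (S m) (Nat.le_refl _)) as [a' [b' Hl']].
      exists (fun i => if Nat.eqb i (S m) then a' else a i),
             (fun i => if Nat.eqb i (S m) then b' else b i).
      intros i Hi. destruct (Nat.eqb_spec i (S m)) as [->|]; [assumption|].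
      apply Hl. lia. }
  destruct Hab as [a [b Hab]].
  assert (Hsum : forall k, sum_n (fun i => Cmult (lambda i) (RtoC (IZR (B k i)))) m
    = Cplus (RtoC (IZR (zsum (fun i => a i * B k i)%Z m)))
          (Cmult (RtoC (IZR (zsum (fun i => b i * B k i)%Z m))) (qomega d))).
  { intros k. rewrite <- sum_n_lin_comb. apply sum_n_ext_loc.
    intros i Hi. now rewrite Hab. }
  apply NNPP. intros Hno. apply Hnz.
  assert (Hzero : forall k, (k <= m)%nat ->
    zsum (fun i => a i * B k i)%Z m = 0%Z /\ zsum (fun i => b i * B k i)%Z m = 0%Z).
  { intros k Hk. apply (ZI_comb_eq_0 d); [assumption|]. rewrite <- Hsum.
    apply NNPP. intros Hne. apply Hno. exists k. split; [assumption|].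
    apply (Cmod_in_ZI_ge_1 d); try assumption.
    rewrite Hsum. eexists; eexists; reflexivity. }
  rewrite Hab by assumption.
  rewrite (diag_unit_mod_injective N B m a), (diag_unit_mod_injective N B m b)
    by (try assumption; intros k Hk; apply Hzero; assumption).
  ring.
Qed.

Lemma exp_linear_form_lower_bound (d : Z) (m M q N : nat) (beta : nat -> nat)
  (lambda : nat -> C) (H : R) :
  (0 < d)%Z -> (1 <= M)%nat -> beta 0%nat = 0%nat ->
  (forall i j, (i <= m)%nat -> (j <= m)%nat -> beta i = beta j -> i = j) ->
  (forall j, (j <= m)%nat -> (beta j <= M)%nat) ->
  (forall i, (i <= m)%nat -> in_ZI d (lambda i)) ->
  (exists i, (i <= m)%nat /\ lambda i <> RtoC 0) ->
  (forall i, (1 <= i <= m)%nat -> Cmod (lambda i) <= H) ->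
  N = (fact M * q + 1)%nat -> (1 < N)%nat ->
  2 * (INR m * (H * (INR M * exp (INR M) * INR M ^ ((m + 1) * N)))) <= INR (fact (N - 1)) ->
  INR (fact (N - 1)) <= 2 * INR (fact ((m + 1) * N + M)) * Cmod (P_at_e m lambda beta).
Proof.
  intros Hd HM Hb0 Hinj HbM HZ Hnz HH HN HN1 Hbig.
  set (cs := fun k b => shifts beta (dec_at N k) b (seq 0 (S m))).
  set (A := fun k i => hmomZ 0 (cs k (Z.of_nat (beta i)))).
  set (f := Z.of_nat (fact (N - 1))).
  assert (Hf : (0 < f)%Z) by (pose proof (lt_O_fact (N - 1)); unfold f; lia).
  set (B := fun k i => (A k i / f)%Z).
  assert (HB : forall k i, (k <= m)%nat -> (i <= m)%nat ->
    A k i = (f * B k i)%Z /\ (i <> k -> (Z.of_nat N | B k i)%Z)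
    /\ (i = k -> rel_prime (Z.of_nat N) (B k i))).
  { intros k i Hk Hi.
    destruct (hmomZ_shifts_mod beta m M q N k i Hinj HbM HN HN1 Hk Hi) as [B0 [HA HB0]].
    fold f (cs k (Z.of_nat (beta i))) in HA. fold (A k i) in HA.
    unfold B. rewrite HA. replace (f * B0 / f)%Z with B0; [tauto|].
    rewrite Z.mul_comm, Z.div_mul; lia. }
  destruct (exists_nonzero_comb d (Z.of_nat N) B m lambda) as [k [Hk HW]];
    try assumption; [lia| | |].
  { intros k i Hk Hi. apply HB; assumption. }
  { intros k Hk. apply HB; auto. }
  set (W := sum_n (fun i => Cmult (lambda i) (RtoC (IZR (B k i)))) m) in HW.
  set (g := fun i => Cmult (lambda i)
      (RtoC (IZR (A k 0%nat) * exp 1 ^ beta i - IZR (A k i)))).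
  (* Clearing by A_{k,0} separates (N-1)! W, of modulus at least (N-1)!, from the remainders, which
     the size hypothesis keeps below half of (N-1)!. *)
  assert (HP : Cmult (RtoC (IZR (A k 0%nat))) (P_at_e m lambda beta)
               = Cplus (Cmult (RtoC (IZR f)) W) (sum_n g m)).
  { unfold W, P_at_e.
    rewrite <- !(sum_n_mult_l (K := C_Ring)).
    change Cplus with (@plus C_AbelianMonoid).
    rewrite <- (sum_n_plus (G := C_AbelianMonoid)).
    apply sum_n_ext_loc. intros i Hi.
    unfold g. destruct (HB k i Hk Hi) as [-> _].
    unfold mult, plus; simpl. eq_in_C.
    rewrite mult_IZR, RtoC_minus, !RtoC_mult. ring. }
  set (E := INR M * exp (INR M) * INR M ^ ((m + 1) * N)) in *.
  assert (HM1 : 1 <= INR M) by (apply (le_INR 1); assumption).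
  assert (Hlen : forall b, (length (cs k b) <= (m + 1) * N)%nat).
  { intros b. eapply Nat.le_trans; [apply shifts_length with (N := N)|].
    - intros j. unfold dec_at. destruct (Nat.eqb j k); lia.
    - rewrite length_seq. lia. }
  assert (Hcs : forall c, In c (map IZR (cs k 0%Z)) -> - INR M <= c <= 0).
  { intros c Hc. apply in_map_iff in Hc. destruct Hc as [z [<- Hz]].
    apply shifts_In in Hz. destruct Hz as [j [Hj ->]]. apply in_seq in Hj.
    specialize (HbM j ltac:(lia)). rewrite Z.sub_0_l, opp_IZR, <- INR_IZR_INZ.
    apply le_INR in HbM. pose proof (pos_INR (beta j)). lra. }
  assert (HA0 : IZR (A k 0%nat) = hmom 0 (map IZR (cs k 0%Z))).
  { unfold A. rewrite Hb0. now rewrite hmom_IZR. }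
  assert (Hg : Cmod (sum_n g m) <= INR m * (H * E)).
  { apply Cmod_sum_n_le.
    - unfold g. rewrite Hb0, pow_O, Rmult_1_r, Rminus_diag. ring.
    - intros i Hi. unfold g. rewrite Cmod_mult, Cmod_R.
      apply Rmult_le_compat; [apply Cmod_ge_0 | apply Rabs_pos | now apply HH |].
      replace (exp 1 ^ beta i) with (exp (INR (beta i))) by
        (rewrite <- Rpower_pow by apply exp_pos; unfold Rpower; rewrite ln_exp; f_equal; ring).
      rewrite HA0, Rmult_comm.
      replace (IZR (A k i)) with (hmom 0 (map (Rplus (INR (beta i))) (map IZR (cs k 0%Z)))).
      + eapply Rle_trans; [apply hmom_shift_approx with (M := INR M)|].
        * split; [apply pos_INR|]. apply le_INR, HbM. lia.
        * assumption.
        * unfold E. apply Rmult_le_compat_l.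
          { apply Rmult_le_pos; [lra | left; apply exp_pos]. }
          apply Rle_pow; [assumption|]. rewrite length_map. apply Hlen.
      + unfold A. rewrite <- hmom_IZR. f_equal. unfold cs.
        rewrite (shifts_translate _ _ (Z.of_nat (beta i))), !map_map.
        apply map_ext. intros z. now rewrite plus_IZR, <- INR_IZR_INZ. }
  assert (HA : Rabs (IZR (A k 0%nat)) <= INR (fact ((m + 1) * N + M))).
  { assert (Habs : forall c, In c (map IZR (cs k 0%Z)) -> Rabs c <= INR M)
      by (intros c Hc; apply Hcs in Hc; apply Rabs_le; lra).
    pose proof (hmom_bound M (map IZR (cs k 0%Z)) 0 Habs) as Hb.
    rewrite <- HA0, length_map in Hb. cbn [fact Nat.add INR] in Hb.
    assert (1 <= INR (fact M)) by (apply (le_INR 1), lt_O_fact).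
    assert (INR (fact (M + length (cs k 0%Z))) <= INR (fact ((m + 1) * N + M))).
    { apply le_INR, fact_le. specialize (Hlen 0%Z). lia. }
    pose proof (Rabs_pos (IZR (A k 0%nat))). nra. }
  assert (Htri : IZR f * Cmod W <= Rabs (IZR (A k 0%nat)) * Cmod (P_at_e m lambda beta)
                 + Cmod (sum_n g m)).
  { rewrite <- Cmod_R, <- Cmod_mult, HP.
    replace (IZR f * Cmod W) with (Cmod (Cmult (RtoC (IZR f)) W)).
    2:{ rewrite Cmod_mult, Cmod_R, Rabs_pos_eq; [reflexivity|]. apply IZR_le; lia. }
    replace (Cmult (RtoC (IZR f)) W) with
      (Cplus (Cplus (Cmult (RtoC (IZR f)) W) (sum_n g m)) (Copp (sum_n g m))) at 1 by ring.
    eapply Rle_trans; [apply Cmod_triangle|]. rewrite Cmod_opp. lra. }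
  assert (Hff : INR (fact (N - 1)) = IZR f) by apply INR_IZR_INZ.
  rewrite Hff in *. apply IZR_lt in Hf.
  pose proof (Cmod_ge_0 (P_at_e m lambda beta)).
  assert (Rabs (IZR (A k 0%nat)) * Cmod (P_at_e m lambda beta)
    <= INR (fact ((m + 1) * N + M)) * Cmod (P_at_e m lambda beta))
    by (apply Rmult_le_compat_r; assumption).
  assert (IZR f * 1 <= IZR f * Cmod W) by (apply Rmult_le_compat_l; lra).
  lra.
Qed.

(** * Choice of the parameter N *)

Lemma exp_pow_nat (x : R) (n : nat) : exp (INR n * x) = exp x ^ n.
Proof.
  rewrite <- Rpower_pow by apply exp_pos. unfold Rpower. now rewrite ln_exp.
Qed.

(** * Explicit inequalities for exp and ln *)

Lemma exp_1_lower : 2.7 <= exp 1.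
Proof.
  assert (H : (1 + 1 / 128) ^ 128 <= exp 1).
  { replace (exp 1) with (exp (INR 128 * (1 / 128))) by (f_equal; simpl; field).
    rewrite exp_pow_nat. apply pow_incr. pose proof (exp_ineq1_le (1 / 128)). lra. }
  eapply Rle_trans; [|exact H]. lra.
Qed.

Lemma exp_1_upper : exp 1 <= 2.72.
Proof.
  assert (H : (1 + -1 / 1024) ^ 1024 <= exp (Ropp 1)).
  { replace (exp (Ropp 1)) with (exp (INR 1024 * (-1 / 1024))).
    2:{ f_equal. rewrite INR_IZR_INZ. change (Z.of_nat 1024) with 1024%Z. lra. }
    rewrite exp_pow_nat. apply pow_incr. pose proof (exp_ineq1_le (-1 / 1024)). lra. }
  (* Cleared of denominators this is 100 * 1024^1024 <= 272 * 1023^1024, decided by integer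
     computation. *)
  assert (H1 : / 2.72 <= (1 + -1 / 1024) ^ 1024).
  { replace (1 + -1 / 1024) with (1023 / 1024) by field.
    unfold Rdiv. rewrite Rpow_mult_distr, pow_inv, !pow_IZR.
    apply Rmult_le_reg_r with (IZR (1024 ^ Z.of_nat 1024)).
    { apply IZR_lt. reflexivity. }
    rewrite Rmult_assoc, Rinv_l, Rmult_1_r.
    2:{ apply not_0_IZR. vm_compute. discriminate. }
    apply Rmult_le_reg_l with 272; [lra|].
    replace (272 * (/ 2.72 * IZR (1024 ^ Z.of_nat 1024)))
      with (100 * IZR (1024 ^ Z.of_nat 1024))
      by (generalize (IZR (1024 ^ Z.of_nat 1024)); intros; lra).
    rewrite <- !mult_IZR. apply IZR_le. vm_compute. discriminate. }
  rewrite exp_Ropp in H. apply (Rle_trans _ _ _ H1) in H.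
  pose proof (exp_pos 1). apply Rinv_le_contravar in H; [|lra].
  rewrite !Rinv_inv in H. assumption.
Qed.

(** With p = k/q, the bound follows from e^k <= 2.72^k <= a^q, a comparison of rational powers. *)
Lemma ln_lower (a p : R) (q : nat) (k : nat) :
  0 < a -> 2.72 ^ k <= a ^ q -> INR q * p = INR k -> (0 < q)%nat -> p <= ln a.
Proof.
  intros Ha Hle Hp Hq. apply lt_0_INR in Hq.
  apply Rmult_le_reg_l with (INR q); [assumption|].
  rewrite Hp, <- ln_pow by assumption.
  rewrite <- (ln_exp (INR k)). apply ln_le; [apply exp_pos|].
  rewrite <- (Rmult_1_r (INR k)), exp_pow_nat.
  eapply Rle_trans; [|exact Hle]. apply pow_incr.
  pose proof exp_1_upper. pose proof (exp_pos 1). lra.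
Qed.

Lemma ln_4_lower : 1.38 <= ln 4.
Proof. apply (ln_lower 4 1.38 50 69); try lra; try lia. rewrite !INR_IZR_INZ; simpl; lra. Qed.

Lemma ln_11_lower : 2.375 <= ln 11.
Proof. apply (ln_lower 11 2.375 8 19); try lra; try lia. rewrite !INR_IZR_INZ; simpl; lra. Qed.

Lemma ln_2_upper : ln 2 <= 0.7.
Proof.
  rewrite <- (ln_exp 0.7). apply ln_le; [lra|].
  (* Otherwise e^7 = (exp 0.7)^10 would be at most 2^10 = 1024, while 2.7^7 > 1046. *)
  apply Rnot_lt_le. intros Hlt.
  assert (exp 0.7 ^ 10 <= 2 ^ 10) by (apply pow_incr; pose proof (exp_pos 0.7); lra).
  rewrite <- exp_pow_nat in H. replace (INR 10 * 0.7) with (INR 7 * 1) in H by (simpl; lra).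
  rewrite exp_pow_nat in H.
  assert (2.7 ^ 7 <= exp 1 ^ 7) by (apply pow_incr; pose proof exp_1_lower; lra).
  lra.
Qed.

Lemma ln_le_sub_1 (x : R) : 0 < x -> ln x <= x - 1.
Proof.
  intros Hx. pose proof (exp_ineq1_le (ln x)). rewrite exp_ln in H by assumption. lra.
Qed.

(** This is the tangent to the concave function ln at exp t. It is used at t = ln 2 for moderate y
    and at t = 4 where a small slope matters. *)
Lemma ln_tangent (t y : R) : 0 < y -> ln y <= y * exp (- t) + t - 1.
Proof.
  intros Hy. pose proof (ln_le_sub_1 (y * exp (- t))) as H.
  rewrite ln_mult, ln_exp in H by (try apply exp_pos; assumption).
  pose proof (exp_pos (- t)). specialize (H ltac:(nra)). lra.
Qed.

Lemma ln_half_bound (y : R) : 0 < y -> ln y <= y / 2 - 0.3.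
Proof.
  intros Hy. pose proof (ln_tangent (ln 2) y Hy) as H.
  rewrite exp_Ropp, exp_ln in H by lra. pose proof ln_2_upper. lra.
Qed.

Lemma ln_far_bound (y : R) : 0 < y -> ln y <= 0.02 * y + 3.
Proof.
  intros Hy. pose proof (ln_tangent 4 y Hy) as H.
  assert (exp (Ropp 4) <= 0.02).
  { rewrite exp_Ropp. replace 0.02 with (/ 50) by lra. apply Rinv_le_contravar; [lra|].
    replace 4 with (INR 4 * 1) by (simpl; ring). rewrite exp_pow_nat.
    apply Rle_trans with (2.7 ^ 4); [lra|]. apply pow_incr. pose proof exp_1_lower; lra. }
  nra.
Qed.

Lemma exp_ge_mul (u : R) : 0 <= u -> 2.7 * u <= exp u.
Proof.
  intros Hu. replace u with (1 + (u - 1)) at 2 by ring. rewrite exp_plus.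
  pose proof (exp_ineq1_le (u - 1)). pose proof exp_1_lower. nra.
Qed.

(* In the application [x = ln (ln H)] and [exp x / (y - ln y)] is the target value of [N]:
   it makes [N * (ln N - K)] just exceed [ln H], where [K = x - y]. *)
Lemma parameter_bounds (M m l x y : R) :
  4 <= M -> 1 <= m -> m + 1 <= M -> 1.38 <= l -> M * l ^ 2 + l <= x ->
  y = x - ((m + 1) * l + 1.1) ->
  1 <= y /\ 1 <= y - ln y <= y /\ x <= 8 * (y - ln y) /\
  (11 <= M -> 2.375 <= l -> x <= 2 * (y - ln y)).
Proof.
  intros HM Hm HmM Hl Hx Hy.
  assert (HK : (m + 1) * l <= M * l) by (apply Rmult_le_compat_r; lra).
  assert (Hy1 : 1 <= y).
  (* Indeed y >= M l (l - 1) + l - 1.1. *)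
  { assert (4 * 1.38 * 0.38 <= M * l * (l - 1)) by (apply Rmult_le_compat; nra). nra. }
  pose proof (ln_le_sub_1 y ltac:(lra)).
  pose proof (ln_le 1 y ltac:(lra) Hy1) as Hln. rewrite ln_1 in Hln.
  repeat split; try lra.
  (* As y - ln y >= y/2 + 0.3, it suffices that x <= 4y + 2.4, which follows from M l (3l - 4) + 3l
     >= 2. *)
  - pose proof (ln_half_bound y ltac:(lra)).
    assert (4 * 1.38 * 0.14 <= M * l * (3 * l - 4)) by (apply Rmult_le_compat; nra).
    nra.
  - intros HM11 Hl11. pose proof (ln_far_bound y ltac:(lra)).
    (* As y - ln y >= 0.98 y - 3, it suffices that x <= 1.96 y - 6, which follows from M l (0.96 l -
       1.96) + 0.96 l >= 8.156. *)
    assert (11 * 2.375 * 0.32 <= M * l * (0.96 * l - 1.96)) by (apply Rmult_le_compat; nra).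
    nra.
Qed.

(* Makes rounding [N] up to [1 mod M!] negligible: [M! <= M^(M-1) = exp ((M-1) * l)]. *)
Lemma exp_gap_bound (M l x : R) :
  4 <= M -> 1.38 <= l -> exp l = M -> M * l ^ 2 + l <= x ->
  M * exp ((M - 1) * l) * (x + l + 2) * x <= 4 * exp x.
Proof.
  intros HM Hl HlM Hx.
  assert (Hl2 : 1.9 <= l ^ 2) by nra.
  assert (Hx9 : 8.9 <= x) by nra.
  assert (H5l : 5 * l <= x) by nra.
  (* Since 0.725 * 1.38 >= 1, one has M l^2 <= x - l <= l (0.725 x - 1), and 0.275 = 1 - 0.725. *)
  assert (HMl : (M - 1) * l <= x - (0.275 * x + 1 + l)).
  { apply Rmult_le_reg_l with l; [lra|]. nra. }
  (* The surplus exp(0.275 x) must absorb the quadratic factor (x + l + 2) x. *)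
  assert (Hsq : 0.137 * x ^ 2 <= exp (0.275 * x)).
  { pose proof (exp_ge_mul (0.1375 * x) ltac:(lra)).
    replace (0.275 * x) with (INR 2 * (0.1375 * x)) by (simpl; lra).
    rewrite exp_pow_nat. apply Rle_trans with ((0.371 * x) ^ 2); [nra|].
    apply pow_incr. lra. }
  assert (Hz : 2.7 * M * (0.137 * x ^ 2) <= exp (x - (M - 1) * l)).
  { apply Rle_trans with (exp (1 + l + 0.275 * x)).
    - rewrite !exp_plus, HlM. pose proof exp_1_lower.
      apply Rmult_le_compat; nra.
    - apply exp_le_compat. lra. }
  replace (exp x) with (exp ((M - 1) * l) * exp (x - (M - 1) * l))
    by (rewrite <- exp_plus; f_equal; ring).
  pose proof (exp_pos ((M - 1) * l)).
  assert (M * ((x + l + 2) * x) <= 4 * (2.7 * M * (0.137 * x ^ 2))).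
  { replace (4 * (2.7 * M * (0.137 * x ^ 2))) with (M * (1.4796 * x * x)) by lra.
    apply Rmult_le_compat_l; [lra|]. apply Rmult_le_compat_r; lra. }
  nra.
Qed.

(** * Growth of factorials and of x ln x *)

Lemma fact_lt_pow (M : nat) :
  (4 <= M)%nat -> (fact M + 2 * M + 2 <= M ^ (M - 1))%nat.
Proof.
  induction M as [|M IH]; intros HM; [lia|].
  destruct (Nat.eq_dec M 3) as [->|]; [vm_compute; lia|].
  specialize (IH ltac:(lia)).
  assert (H1 : (M ^ (M - 1) <= (S M) ^ (M - 1))%nat) by (apply Nat.pow_le_mono_l; lia).
  replace (S M - 1)%nat with (S (M - 1)) by lia. rewrite Nat.pow_succ_r'.
  change (fact (S M)) with (S M * fact M)%nat. nia.
Qed.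

Lemma xlnx_ge (n N K : R) : 0 < n <= N -> K <= ln n -> n * (ln n - K) <= N * (ln N - K).
Proof.
  intros Hn HK. pose proof (ln_le n N ltac:(lra) ltac:(lra)).
  apply Rmult_le_compat; lra.
Qed.

(** By convexity the increment of x ln x is at most N - n times the derivative at N; it measures the
    cost of rounding n up to N. *)
Lemma xlnx_increment (n N : R) : 0 < n <= N -> N * ln N <= n * ln n + (N - n) * (ln N + 1).
Proof.
  intros Hn. pose proof (ln_le_sub_1 (N / n) ltac:(apply Rdiv_lt_0_compat; lra)) as H.
  rewrite ln_div in H by lra.
  assert (n * (ln N - ln n) <= n * (N / n - 1)) by (apply Rmult_le_compat_l; lra).
  replace (n * (N / n - 1)) with (N - n) in H0 by (field; lra). nra.
Qed.

Lemma exists_in_progression (F : nat) (n : R) :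
  (0 < F)%nat -> 1 < n -> exists q : nat, n <= INR (F * q + 1) <= n + INR F.
Proof.
  intros HF Hn. apply lt_0_INR in HF as HF'.
  destruct (archimed ((n - 1) / INR F)) as [H1 H2].
  set (z := up ((n - 1) / INR F)) in *.
  assert (0 < (n - 1) / INR F) by (apply Rdiv_lt_0_compat; lra).
  assert (0 < z)%Z by (apply lt_IZR; lra).
  exists (Z.to_nat z). rewrite plus_INR, mult_INR, (INR_IZR_INZ (Z.to_nat z)), Z2Nat.id by lia.
  assert (Heq : (n - 1) = INR F * ((n - 1) / INR F)) by (field; lra).
  simpl (INR 1). nra.
Qed.

(** A weak Stirling bound; the induction step is (1 + 1/N)^N <= e. *)
Lemma pow_le_exp_fact (N : nat) : INR N ^ N <= exp (INR N) * INR (fact N).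
Proof.
  induction N as [|N IH]; [simpl; rewrite exp_0; lra|].
  destruct (Nat.eq_dec N 0) as [->|HN].
  { simpl. pose proof (exp_ineq1_le 1). lra. }
  assert (HN0 : 0 < INR N) by (apply lt_0_INR; lia).
  assert (H : INR (S N) ^ N <= exp 1 * INR N ^ N).
  { replace (INR (S N)) with ((1 + / INR N) * INR N) by (rewrite S_INR; field; lra).
    rewrite Rpow_mult_distr. apply Rmult_le_compat_r; [apply pow_le; lra|].
    replace (exp 1) with (exp (INR N * / INR N)) by (f_equal; field; lra).
    rewrite exp_pow_nat. apply pow_incr. pose proof (exp_ineq1_le (/ INR N)).
    pose proof (Rinv_0_lt_compat _ HN0). lra. }
  change (fact (S N)) with (S N * fact N)%nat. rewrite mult_INR, <- tech_pow_Rmult.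
  rewrite (S_INR N) at 3. rewrite exp_plus.
  pose proof (lt_0_INR (S N) ltac:(lia)). pose proof (exp_pos 1).
  assert (INR (S N) * INR (S N) ^ N <= INR (S N) * (exp 1 * INR N ^ N))
    by (apply Rmult_le_compat_l; lra).
  assert (exp 1 * INR N ^ N <= exp 1 * (exp (INR N) * INR (fact N)))
    by (apply Rmult_le_compat_l; lra).
  assert (INR (S N) * (exp 1 * INR N ^ N) <= INR (S N) * (exp 1 * (exp (INR N) * INR (fact N))))
    by (apply Rmult_le_compat_l; lra).
  lra.
Qed.

Lemma exp_le_fact_pred (N : nat) :
  (1 <= N)%nat ->
  exp (INR N * ln (INR N) - INR N - ln (INR N)) <= INR (fact (N - 1)).
Proof.
  intros HN. pose proof (pow_le_exp_fact N) as H. apply lt_0_INR in HN as HN0.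
  replace (fact N) with (N * fact (N - 1))%nat in H.
  2:{ destruct N as [|N]; [lia|]. now replace (S N - 1)%nat with N by lia. }
  rewrite mult_INR in H.
  unfold Rminus. rewrite !exp_plus, !exp_Ropp, exp_pow_nat, !exp_ln by assumption.
  pose proof (exp_pos (INR N)).
  apply Rmult_le_reg_r with (exp (INR N) * INR N); [nra|].
  replace (INR N ^ N * / exp (INR N) * / INR N * (exp (INR N) * INR N)) with (INR N ^ N)
    by (field; lra). lra.
Qed.

Lemma fact_add_le (a b : nat) : (fact (a + b) <= fact a * (a + b) ^ b)%nat.
Proof.
  induction b as [|b IH].
  - rewrite Nat.add_0_r. simpl. lia.
  - rewrite Nat.add_succ_r. change (fact (S (a + b))) with (S (a + b) * fact (a + b))%nat.
    rewrite Nat.pow_succ_r'.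
    rewrite (Nat.mul_comm (fact a)), <- Nat.mul_assoc, (Nat.mul_comm _ (fact a)).
    apply Nat.mul_le_mono_l. eapply Nat.le_trans; [exact IH|].
    apply Nat.mul_le_mono_l, Nat.pow_le_mono_l. lia.
Qed.

(** * Estimates for the chosen N *)

Lemma small_terms_bound (M : nat) (l x w N : R) :
  (4 <= M)%nat -> l = ln (INR M) -> 1.38 <= l -> INR M * l ^ 2 + l <= x ->
  1 <= w <= x -> exp x / w <= N <= exp x / w + INR (fact M) ->
  INR M * ((INR (fact M) + 2 * INR M + 2) * (ln N + l + 1)) <= 4 * (exp x / w).
Proof.
  intros HM Hl Hl1 Hx Hw HN.
  assert (HM4 : 4 <= INR M) by (apply (le_INR 4) in HM; simpl in HM; lra).
  assert (HlM : exp l = INR M) by (subst l; apply exp_ln; lra).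
  pose proof (exp_gap_bound (INR M) l x HM4 Hl1 HlM Hx) as Hgap.
  assert (Hpow : INR (fact M) + 2 * INR M + 2 <= exp ((INR M - 1) * l)).
  { pose proof (le_INR _ _ (fact_lt_pow M HM)) as H.
    rewrite pow_INR, !plus_INR, mult_INR in H. simpl (INR 2) in H.
    replace (INR M - 1) with (INR (M - 1)) by (rewrite minus_INR by lia; simpl; ring).
    rewrite exp_pow_nat, HlM. lra. }
  set (Q := exp ((INR M - 1) * l)) in *. set (n := exp x / w) in *.
  assert (Hx0 : 0 < x) by lra.
  assert (Hnw : exp x = n * w) by (unfold n; field; lra).
  assert (Hn : exp x / x <= n).
  { unfold n, Rdiv. apply Rmult_le_compat_l; [left; apply exp_pos|].
    apply Rinv_le_contravar; lra. }
  assert (Hkey : INR M * Q * (x + l + 2) <= 4 * n).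
  { apply Rle_trans with (4 * (exp x / x)); [|lra].
    apply Rmult_le_reg_r with x; [assumption|].
    replace (4 * (exp x / x) * x) with (4 * exp x) by (field; lra). lra. }
  pose proof (INR_fact_lt_0 M) as HF.
  assert (HQ : 0 < Q) by apply exp_pos.
  assert (HFn : INR (fact M) <= n).
  { assert (4 * Q <= INR M * Q * (x + l + 2)).
    { apply Rle_trans with (4 * Q * 1); [lra|]. apply Rmult_le_compat; try lra.
      apply Rmult_le_compat_r; lra. }
    lra. }
  (* Here N <= n + M! <= 2n <= 2 exp x. *)
  assert (HlnN : ln N <= x + 1).
  { apply Rle_trans with (ln (2 * exp x)).
    - apply ln_le; [lra|]. assert (n <= exp x) by (rewrite Hnw; nra). lra.
    - rewrite ln_mult, ln_exp by (try apply exp_pos; lra). pose proof ln_2_upper. lra. }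
  apply Rle_trans with (INR M * (Q * (x + l + 2))); [|lra].
  apply Rmult_le_compat_l; [lra|].
  apply Rle_trans with (Q * (ln N + l + 1)); [|apply Rmult_le_compat_l; lra].
  destruct (Rle_lt_dec 0 (ln N + l + 1)); [apply Rmult_le_compat_r; lra|].
  exfalso. assert (HN1 : 1 <= N).
  { pose proof (le_INR 1 _ (lt_O_fact M)). simpl in H. lra. }
  apply ln_le in HN1; [|lra]. rewrite ln_1 in HN1. lra.
Qed.

(** The constant 1.1 covers the loss exp(-N) in the Stirling bound and 0.1 N for ln N + 3M. Of this,
    2M comes from 2 m M <= exp(2M) and M from the factor exp M. *)
Lemma remainder_condition (m M N : nat) (l L : R) :
  (4 <= M)%nat -> (1 <= m)%nat -> (m + 1 <= M)%nat -> (1 <= N)%nat -> l = ln (INR M) ->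
  ln (INR N) + 3 * INR M <= 0.1 * INR N ->
  L <= INR N * (ln (INR N) - ((INR m + 1) * l + 1.1)) ->
  2 * (INR m * (exp L * (INR M * exp (INR M) * INR M ^ ((m + 1) * N)))) <= INR (fact (N - 1)).
Proof.
  intros HM Hm HmM HN Hl Hsmall HL.
  eapply Rle_trans; [|apply exp_le_fact_pred; assumption].
  assert (HM4 : 4 <= INR M) by (apply (le_INR 4) in HM; simpl in HM; lra).
  apply le_INR in HmM. rewrite plus_INR in HmM. simpl (INR 1) in HmM.
  pose proof (pos_INR m).
  assert (HlM : exp l = INR M) by (subst l; apply exp_ln; lra).
  assert (HMe : 2 * INR m * INR M <= exp (INR M) * exp (INR M)).
  { pose proof (exp_ge_mul (INR M) ltac:(lra)).
    apply Rle_trans with ((2.7 * INR M) * (2.7 * INR M)); [nra|].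
    apply Rmult_le_compat; lra. }
  rewrite <- HlM at 3. rewrite <- exp_pow_nat, mult_INR, plus_INR. simpl (INR 1).
  apply Rle_trans with
    (exp (INR M) * exp (INR M) * (exp L * exp (INR M) * exp ((INR m + 1) * INR N * l))).
  - replace (2 * (INR m * (exp L * (INR M * exp (INR M) * exp ((INR m + 1) * INR N * l)))))
      with (2 * INR m * INR M * (exp L * exp (INR M) * exp ((INR m + 1) * INR N * l))) by ring.
    apply Rmult_le_compat_r; [|assumption].
    left. repeat apply Rmult_lt_0_compat; apply exp_pos.
  - rewrite <- !exp_plus.
    set (u := INR M + INR M + (L + INR M + (INR m + 1) * INR N * l)).
    set (v := INR N * ln (INR N) - INR N - ln (INR N)).
    assert (u <= v) by (unfold u, v; lra).
    now apply exp_le_compat.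
Qed.

(** With G = (m+1) N + M = (N-1) + r, the quotient G!/(N-1)! is at most G^r, where G <= N M (1 +
    M/N); the factor 2 is absorbed by exp 0.7. *)
Lemma fact_quotient_bound (m M N : nat) :
  (1 <= N)%nat -> (m + 1 <= M)%nat ->
  2 * INR (fact ((m + 1) * N + M)) <=
  INR (fact (N - 1)) *
    exp (0.7 + (INR m * INR N + INR M + 1) * (ln (INR N) + ln (INR M) + INR M / INR N)).
Proof.
  intros HN HmM. set (G := ((m + 1) * N + M)%nat). set (r := (m * N + M + 1)%nat).
  apply lt_0_INR in HN as HN0.
  pose proof (lt_0_INR M ltac:(lia)) as HM0.
  assert (HG : (G = N - 1 + r)%nat) by (unfold G, r; nia).
  pose proof (fact_add_le (N - 1) r) as Hf. rewrite <- HG in Hf.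
  apply le_INR in Hf. rewrite mult_INR, pow_INR in Hf.
  replace (INR m * INR N + INR M + 1) with (INR r)
    by (unfold r; rewrite !plus_INR, mult_INR; simpl; ring).
  rewrite exp_plus, exp_pow_nat.
  assert (HG' : INR G <= exp (ln (INR N) + ln (INR M) + INR M / INR N)).
  { rewrite !exp_plus, !exp_ln by assumption.
    apply Rle_trans with (INR N * INR M * (1 + INR M / INR N)).
    - replace (INR N * INR M * (1 + INR M / INR N)) with (INR (M * N + M * M))
        by (rewrite plus_INR, !mult_INR; field; lra).
      apply le_INR. unfold G. nia.
    - apply Rmult_le_compat_l; [nra|]. apply exp_ineq1_le. }
  assert (2 <= exp 0.7).
  { rewrite <- (exp_ln 2) at 1 by lra. pose proof ln_2_upper.
    now apply exp_le_compat. }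
  pose proof (INR_fact_lt_0 (N - 1)).
  apply Rle_trans with (2 * (INR (fact (N - 1)) * INR G ^ r)); [lra|].
  rewrite <- Rmult_assoc, (Rmult_comm 2), Rmult_assoc.
  apply Rmult_le_compat_l; [lra|].
  apply Rmult_le_compat; try lra. apply pow_le, pos_INR.
  apply pow_incr; split; [apply pos_INR|assumption].
Qed.

(** The dominant term m n ln n is at most m (L + n (K + 0.7)). With m n l and the rounding and
    lower-order terms, at most 4 m n / M, the excess over m L is m n ((m+2) l + 1.8 + 4/M); since n
    = L/w, the last hypothesis compares it with the rho term. *)
Lemma exponent_bound (m M n N F l L x w K rho : R) :
  1 <= m -> 4 <= M -> 1 <= M <= N -> 0 <= l -> 0 < n -> n <= N <= n + F -> 1 <= w ->
  0 < x -> 0 <= ln N ->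
  L = n * w -> ln n = x - ln w -> K = (m + 1) * l + 1.1 ->
  x - ln w <= w + K + 0.7 ->
  M * ((F + 2 * M + 2) * (ln N + l + 1)) <= 4 * n ->
  m * ((m + 2) * l + 1.8 + 4 / M) * x < rho * ((m + 1) * (m + 2)) * l * w ->
  0.7 + (m * N + M + 1) * (ln N + l + M / N)
    < (m + rho * (m ^ 2 + 3 * m + 2) * l / x) * L.
Proof.
  intros Hm HM HMN Hl Hn HN Hw Hx HlnN HL Hlnn HK Hxw Hsmall Hrho.
  pose proof (xlnx_increment n N ltac:(lra)) as Hinc.
  assert (H1 : (N - n) * (ln N + 1) <= F * (ln N + 1)) by (apply Rmult_le_compat_r; lra).
  assert (HMN1 : M / N <= 1).
  { apply Rmult_le_reg_r with N; [lra|]. unfold Rdiv. rewrite Rmult_assoc, Rinv_l; lra. }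
  assert (Hsmall' : (F + 2 * M + 2) * (ln N + l + 1) <= 4 / M * n).
  { apply Rmult_le_reg_l with M; [lra|].
    replace (M * (4 / M * n)) with (4 * n) by (field; lra). assumption. }
  set (S := ln N + l + 1) in *.
  assert (HS : 1 <= S) by (unfold S; lra).
  assert (H2 : (m * N + M + 1) * (ln N + l + M / N)
               <= m * (N * ln N) + m * (N * l) + m * M + (M + 1) * S).
  { replace ((m * N + M + 1) * (ln N + l + M / N)) with
      (m * (N * ln N) + m * (N * l) + m * M + (M + 1) * (ln N + l + M / N)) by (field; lra).
    apply Rplus_le_compat_l, Rmult_le_compat_l; unfold S; lra. }
  assert (H3 : N * ln N + N * l <= n * ln n + n * l + F * S).
  { assert (N * l <= n * l + F * l) by nra. unfold S. lra. }
  assert (H4 : n * ln n <= L + n * (K + 0.7)).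
  { rewrite HL, Hlnn. nra. }
  assert (H5 : m * (N * ln N) + m * (N * l) <= m * (L + n * (K + 0.7) + n * l + F * S)).
  { rewrite <- Rmult_plus_distr_l. apply Rmult_le_compat_l; lra. }
  assert (H6 : 0.7 + m * M + (M + 1) * S <= m * ((2 * M + 2) * S)).
  { assert (M * 1 <= M * S) by (apply Rmult_le_compat_l; lra).
    assert (1 * (0.7 + (M + 1) * S) <= m * (0.7 + (M + 1) * S)) by
      (apply Rmult_le_compat_r; lra).
    assert (m * (0.7 + M + (M + 1) * S) <= m * ((2 * M + 2) * S)) by
      (apply Rmult_le_compat_l; lra).
    lra. }
  assert (H7 : m * (F * S) + m * ((2 * M + 2) * S) <= m * (4 / M * n)).
  { rewrite <- Rmult_plus_distr_l. apply Rmult_le_compat_l; [lra|].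
    replace (F * S + (2 * M + 2) * S) with ((F + 2 * M + 2) * S) by ring. assumption. }
  assert (H8 : m * ((m + 2) * l + 1.8 + 4 / M) * n
               < rho * (m ^ 2 + 3 * m + 2) * l / x * L).
  { apply Rmult_lt_reg_r with x; [assumption|].
    replace (rho * (m ^ 2 + 3 * m + 2) * l / x * L * x)
      with (rho * ((m + 1) * (m + 2)) * l * w * n) by (rewrite HL; field; lra).
    replace (m * ((m + 2) * l + 1.8 + 4 / M) * n * x)
      with (m * ((m + 2) * l + 1.8 + 4 / M) * x * n) by ring.
    apply Rmult_lt_compat_r; assumption. }
  subst K. lra.
Qed.

Lemma log_small_terms (M : nat) (l n N : R) :
  (4 <= M)%nat -> 1.38 <= l -> 0 < n <= N -> 1 <= N ->
  INR M * ((INR (fact M) + 2 * INR M + 2) * (ln N + l + 1)) <= 4 * n ->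
  ln N + 3 * INR M <= 0.1 * N.
Proof.
  intros HM Hl Hn HN Hs.
  assert (HM4 : 4 <= INR M) by (apply (le_INR 4) in HM; simpl in HM; lra).
  assert (HF : 6 * INR M <= INR (fact M)).
  { destruct M as [|[|[|[|M]]]]; try lia.
    change (fact (S (S (S (S M))))) with (S (S (S (S M))) * fact (S (S (S M))))%nat.
    rewrite mult_INR, Rmult_comm. apply Rmult_le_compat_l; [apply pos_INR|].
    replace 6 with (INR (fact 3)) by (simpl; ring). apply le_INR, fact_le. lia. }
  pose proof (ln_le 1 N ltac:(lra) HN) as H0. rewrite ln_1 in H0.
  assert (H1 : (8 * INR M + 2) * (ln N + 2.38) <= n).
  { apply Rmult_le_reg_l with 4; [lra|]. eapply Rle_trans; [|exact Hs].
    apply Rmult_le_compat; try lra; [nra|]. apply Rmult_le_compat; lra. }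
  (* The bound [H1] first gives N > e^2; using ln N >= 2 in [H1] again gives the linear term 3M. *)
  assert (H2 : 2 <= ln N).
  { rewrite <- (ln_exp 2). apply ln_le; [apply exp_pos|].
    replace 2 with (INR 2 * 1) by (simpl; ring). rewrite exp_pow_nat.
    apply Rle_trans with (2.72 ^ 2).
    - apply pow_incr. pose proof exp_1_upper. pose proof (exp_pos 1). lra.
    - nra. }
  assert (H3 : (8 * INR M - 8) * 2 <= (8 * INR M - 8) * ln N)
    by (apply Rmult_le_compat_l; lra).
  nra.
Qed.

(** * The lower bound for P(e) *)

Theorem theorem9p1 (d : Z) (hd : squarefree_pos d)
  (m1 m2 : nat) (hm1 : (1 <= m1)%nat) (hm2 : (4 <= m2)%nat)
  (hm12 : (m1 + 1 <= m2)%nat)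
  (beta : nat -> nat) (hb0 : beta 0%nat = 0%nat)
  (hbinj : forall i j, (i <= m1)%nat -> (j <= m1)%nat -> beta i = beta j -> i = j)
  (hbmax : (forall j, (j <= m1)%nat -> (beta j <= m2)%nat) /\
           exists j, (j <= m1)%nat /\ beta j = m2)
  (H : R)
  (hH : ln H >= INR m2 * (ln (INR m2)) ^ 2 * exp (INR m2 * (ln (INR m2)) ^ 2))
  (lambda : nat -> C)
  (hlZ : forall i, (i <= m1)%nat -> in_ZI d (lambda i))
  (hlnz : exists i, (i <= m1)%nat /\ lambda i <> RtoC 0)
  (hlH : forall i, (1 <= i <= m1)%nat -> Cmod (lambda i) <= H) :
  Cmod (P_at_e m1 lambda beta) > lower_bound 12.88 H m1 m2 /\
  ((11 <= m2)%nat -> Cmod (P_at_e m1 lambda beta) > lower_bound 2 H m1 m2).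
Proof.
  assert (HM4 : 4 <= INR m2) by (apply (le_INR 4) in hm2; simpl in hm2; lra).
  assert (Hm1 : 1 <= INR m1) by (apply (le_INR 1) in hm1; simpl in hm1; lra).
  assert (HmM : INR m1 + 1 <= INR m2)
    by (apply le_INR in hm12; rewrite plus_INR in hm12; simpl in hm12; lra).
  set (l := ln (INR m2)) in *. set (L := ln H) in *.
  assert (Hl : 1.38 <= l).
  { pose proof ln_4_lower. pose proof (ln_le 4 (INR m2) ltac:(lra) HM4).
    unfold l. lra. }
  assert (Hbase : 0 < INR m2 * l ^ 2 * exp (INR m2 * l ^ 2)).
  { apply Rmult_lt_0_compat; [nra | apply exp_pos]. }
  assert (HL0 : 0 < L) by lra.
  (* [ln] takes the value 0 at non-positive reals, so L > 0 forces H > 0. *)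
  assert (HH : exp L = H).
  { apply exp_ln. apply Rnot_le_lt. intros Hle. unfold L, ln in HL0.
    destruct (Rlt_dec 0 H); lra. }
  set (x := ln L).
  assert (HxL : exp x = L) by now apply exp_ln.
  (* The logarithm of the hypothesis on H gives M l^2 + l + 2 ln l, and ln l >= 0 is dropped. *)
  assert (Hx : INR m2 * l ^ 2 + l <= x).
  { apply Rle_trans with (ln (INR m2 * l ^ 2 * exp (INR m2 * l ^ 2))).
    - rewrite !ln_mult, ln_exp, ln_pow by (try apply exp_pos; nra).
      pose proof (ln_le 1 l ltac:(lra) ltac:(lra)) as Hll. rewrite ln_1 in Hll.
      fold l. simpl (INR 2). lra.
    - apply ln_le; lra. }
  set (K := (INR m1 + 1) * l + 1.1). set (y := x - K).
  destruct (parameter_bounds (INR m2) (INR m1) l x y) as [Hy [[Hw1 Hwy] [Hw8 Hw2]]];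
    try assumption; [reflexivity|].
  set (w := y - ln y) in *.
  assert (HK0 : 0 <= K) by (unfold K; nra).
  assert (Hwx : w <= x) by (unfold y in Hwy; lra).
  set (n := L / w).
  assert (HLn : L = n * w) by (unfold n; field; lra).
  assert (Hlnw : ln w <= ln y) by (apply ln_le; lra).
  assert (Hlnn : ln n = x - ln w) by (unfold n; apply ln_div; lra).
  (* As w <= y, ln n = x - ln w >= x - ln y = w + K, so n (ln n - K) >= n w = L. *)
  assert (HKn : w <= ln n - K) by (rewrite Hlnn; unfold w, y in *; lra).
  assert (Hn0 : 0 < n) by (apply Rdiv_lt_0_compat; lra).
  assert (Hn1 : 1 < n).
  { rewrite <- (exp_ln n), <- exp_0 by assumption. apply exp_increasing. lra. }
  destruct (exists_in_progression (fact m2) n (lt_O_fact m2) Hn1) as [q Hq].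
  set (N := (fact m2 * q + 1)%nat) in *.
  assert (HN1 : (1 < N)%nat) by (apply INR_lt; simpl; lra).
  assert (Hsmall : INR m2 * ((INR (fact m2) + 2 * INR m2 + 2) * (ln (INR N) + l + 1)) <= 4 * n).
  { unfold n. rewrite <- HxL. apply small_terms_bound; try assumption; [reflexivity|lra|].
    rewrite HxL. exact Hq. }
  pose proof (log_small_terms m2 l n (INR N) hm2 Hl ltac:(lra) ltac:(lra) Hsmall) as Hlog.
  assert (HlnN : 0 <= ln (INR N)).
  { rewrite <- ln_1. apply ln_le; lra. }
  assert (HLN : L <= INR N * (ln (INR N) - K)).
  { apply Rle_trans with (n * (ln n - K)).
    - rewrite HLn. apply Rmult_le_compat_l; lra.
    - apply xlnx_ge; lra. }
  assert (Hform : INR (fact (N - 1)) <=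
    2 * INR (fact ((m1 + 1) * N + m2)) * Cmod (P_at_e m1 lambda beta)).
  { apply (exp_linear_form_lower_bound d m1 m2 q N beta lambda H); try assumption;
      try tauto; try lia.
    - apply hd.
    - rewrite <- HH. apply remainder_condition with l; try assumption; try lia. reflexivity. }
  assert (Hmain : forall rho,
    INR m1 * ((INR m1 + 2) * l + 1.8 + 4 / INR m2) * x
      < rho * ((INR m1 + 1) * (INR m1 + 2)) * l * w ->
    Cmod (P_at_e m1 lambda beta) > lower_bound rho H m1 m2).
  { intros rho Hrho.
    assert (Hexp := exponent_bound (INR m1) (INR m2) n (INR N) (INR (fact m2)) l L x w K rho
      ltac:(lra) ltac:(lra) ltac:(lra) ltac:(lra) Hn0 Hq Hw1 ltac:(lra) HlnN HLn Hlnn eq_refl).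
    (* The tangent at 2 gives y <= 2w, hence ln y - ln w <= ln 2 <= 0.7. *)
    specialize (Hexp ltac:(
      pose proof (ln_half_bound y ltac:(lra));
      pose proof (ln_le y (2 * w) ltac:(lra) ltac:(unfold w; lra)) as Hyw;
      rewrite ln_mult in Hyw by lra; pose proof ln_2_upper; unfold w, y in *; lra)
      Hsmall Hrho).
    pose proof (fact_quotient_bound m1 m2 N ltac:(lia) hm12) as Hquot. fold l in Hquot.
    set (t := 0.7 + _) in *.
    unfold lower_bound, Rpower. fold l L x.
    set (P := Cmod _) in *.
    pose proof (INR_fact_lt_0 (N - 1)) as Hf. pose proof (exp_pos t) as Het.
    assert (HP : 1 <= exp t * P).
    { apply Rmult_le_reg_l with (INR (fact (N - 1))); [assumption|].
      rewrite Rmult_1_r, <- Rmult_assoc. eapply Rle_trans; [exact Hform|].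
      apply Rmult_le_compat_r; [apply Cmod_ge_0 | assumption]. }
    apply Rlt_le_trans with (exp (- t)).
    - apply exp_increasing.
      replace ((- INR m1 - rho * (INR m1 ^ 2 + 3 * INR m1 + 2) * l / x) * L)
        with (- ((INR m1 + rho * (INR m1 ^ 2 + 3 * INR m1 + 2) * l / x) * L))
        by (field; lra). lra.
    - rewrite exp_Ropp. apply Rmult_le_reg_l with (exp t); [assumption|].
      rewrite Rinv_r; lra. }
  assert (Hc0 : 0 <= INR m1 * ((INR m1 + 2) * l + 1.8 + 4 / INR m2)).
  { assert (0 <= (INR m1 + 2) * l) by (apply Rmult_le_pos; lra).
    assert (0 < 4 / INR m2) by (apply Rdiv_lt_0_compat; lra).
    apply Rmult_le_pos; lra. }
  split.
  - apply Hmain.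
    assert (H4M : 4 / INR m2 <= 1).
    { apply Rmult_le_reg_r with (INR m2); [lra|]. unfold Rdiv.
      rewrite Rmult_assoc, Rinv_l; lra. }
    set (c := INR m1 * ((INR m1 + 2) * l + 2.8)).
    assert (Hc : INR m1 * ((INR m1 + 2) * l + 1.8 + 4 / INR m2) <= c)
      by (apply Rmult_le_compat_l; lra).
    (* With x <= 8w this yields rho = 12.88 = 8 * 1.61. *)
    assert (Hc2 : c < 1.61 * ((INR m1 + 1) * (INR m1 + 2)) * l).
    { assert ((0.61 * INR m1 + 1.61) * (INR m1 + 2) * 1.38
              <= (0.61 * INR m1 + 1.61) * (INR m1 + 2) * l)
        by (apply Rmult_le_compat_l; [apply Rmult_le_pos|]; lra).
      pose proof (pow2_ge_0 (INR m1)). unfold c. lra. }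
    apply Rle_lt_trans with (c * (8 * w)).
    + apply Rmult_le_compat; lra.
    + assert (c * (8 * w) < 1.61 * ((INR m1 + 1) * (INR m1 + 2)) * l * (8 * w))
        by (apply Rmult_lt_compat_r; lra). lra.
  - intros hm11. apply Hmain.
    assert (HM11 : 11 <= INR m2) by (apply (le_INR 11) in hm11; simpl in hm11; lra).
    assert (Hl11 : 2.375 <= l).
    { pose proof ln_11_lower. pose proof (ln_le 11 (INR m2) ltac:(lra) HM11).
      unfold l. lra. }
    specialize (Hw2 HM11 Hl11).
    assert (H4M : 4 / INR m2 <= 0.5).
    { apply Rmult_le_reg_r with (INR m2); [lra|]. unfold Rdiv.
      rewrite Rmult_assoc, Rinv_l; lra. }
    set (c := INR m1 * ((INR m1 + 2) * l + 2.3)).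
    assert (Hc : INR m1 * ((INR m1 + 2) * l + 1.8 + 4 / INR m2) <= c)
      by (apply Rmult_le_compat_l; lra).
    (* The difference of the two sides is (m+2) l - 2.3 m, positive since l >= 2.375; with x <= 2w
       this yields rho = 2. *)
    assert (Hc2 : c < (INR m1 + 1) * (INR m1 + 2) * l).
    { assert ((INR m1 + 2) * 2.375 <= (INR m1 + 2) * l)
        by (apply Rmult_le_compat_l; lra).
      unfold c. lra. }
    apply Rle_lt_trans with (c * (2 * w)).
    + apply Rmult_le_compat; lra.
    + assert (c * (2 * w) < (INR m1 + 1) * (INR m1 + 2) * l * (2 * w))
        by (apply Rmult_lt_compat_r; lra). lra.
Qed.
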